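(* For $f,g\in C[-1,1]$ and $x\in[-1,1]$ fixed, the following inequality $$|T(f,g;x)|\le osc_{L_n}(f)\cdot osc_{L_n}(g)\cdot\sum_{1\le k<m\le n}|l_{k,n}(x)\cdot l_{m,n}(x)|\le osc_{L_n}(f)\cdot osc_{L_n}(g)\cdot\left\{\frac{\Lambda_n^2(x)-c\left[1+\cos^2 (nt)\cdot\frac{\pi^2}{6}\right]}{2}\right\}$$ holds, for a suitable constant $c$ and $x=\cos t$.
   Context: Let $n\in\{1,2,\ldots\}$ and let $x_{k,n}=\cos\frac{(2k-1)\pi}{2n}$, $k=1,\dots,n$, be the Chebyshev nodes (the roots of $T_n(x)=\cos(n\arccos x)$). Let $\omega_n(x)=\prod_{k=1}^n(x-x_{k,n})$, and let $l_{k,n}(x)=\frac{\omega_n(x)}{\omega_n'(x_{k,n})(x-x_{k,n})}$, $1\le k\le n$, be the Lagrange fundamental functions. The Lagrange operator is $L_n(f;x)=\sum_{k=1}^nf(x_{k,n})l_{k,n}(x)$, its Lebesgue function is $\Lambda_n(x)=\sum_{k=1}^n|l_{k,n}(x)|$, and $T(f,g;x):=L_n(f\cdot g;x)-L_n(f;x)\cdot L_n(g;x)$. The oscillation is $osc_{L_n}(f):=\max\{|f(x_{k,n})-f(x_{m,n})|:1\le k<m\le n\}$, and similarly for $g$. *)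

(* Defs.v *)
From mathcomp Require Import all_boot all_order all_algebra.
From mathcomp Require Import all_classical all_reals all_analysis.
Import Order.TTheory GRing.Theory Num.Theory.
Import numFieldNormedType.Exports.

Set Implicit Arguments.
Unset Strict Implicit.
Unset Printing Implicit Defensive.

Local Open Scope ring_scope.

(* The index k in {1, ..., n} is encoded by i : 'I_n with k = i.+1. *)
Definition cheb_node (R : realType) (n : nat) (i : 'I_n) : R :=
  cos ((2 * i.+1%:R - 1) * pi / (2 * n%:R)).

Definition cheb_omega (R : realType) (n : nat) : {poly R} :=
  \prod_(i < n) ('X - (cheb_node R i)%:P).

(* The quotient by x - x_k is taken in R[X], where the division is exact, so
   that l_k is defined (with value 1) at x_k too. *)
Definition lagrange_fund (R : realType) (n : nat) (i : 'I_n) : {poly R} :=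
  ((cheb_omega R n)^`()%R.[cheb_node R i])^-1 *:
    (cheb_omega R n %/ ('X - (cheb_node R i)%:P)).

Definition lagrange_op (R : realType) (n : nat) (f : R -> R) (x : R) : R :=
  \sum_(i < n) f (cheb_node R i) * (lagrange_fund R i).[x].

Definition lebesgue_fun (R : realType) (n : nat) (x : R) : R :=
  \sum_(i < n) `|(lagrange_fund R i).[x]|.

Definition cebysev_T (R : realType) (n : nat) (f g : R -> R) (x : R) : R :=
  lagrange_op n (f \* g) x - lagrange_op n f x * lagrange_op n g x.

(* For n = 1 there is no pair k < m and the oscillation is 0. *)
Definition osc (R : realType) (n : nat) (f : R -> R) : R :=
  \big[Num.max/0]_(p : 'I_n * 'I_n | (p.1 < p.2)%N)
    `|f (cheb_node R p.1) - f (cheb_node R p.2)|.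

(* Main.v *)
(* Since sum_k l_k = 1, T(f, g) is the sum over k < m of
   l_k l_m (f(x_k) - f(x_m)) (g(x_k) - g(x_m)); and the sum over k < m of
   |l_k l_m| is (Lambda_n^2 - sum_k l_k^2) / 2. As cos^2 (nt) <= 1, a lower
   bound sum_k l_k(cos t)^2 >= 1/16 uniform in n and t suffices. The vectors
   (cos (j theta_k))_k, j < n, are orthogonal, and their scalar products with
   (l_k(cos t))_k are the cos (jt), by exactness of the interpolation of T_j.
   Bessel's inequality then gives sum_k l_k^2 >= (1/n) sum_{j < n} cos^2 (jt),
   which is bounded below because cos^2 a and cos^2 (2a) are not both small. *)
Require Import Defs.
From mathcomp Require Import all_boot all_order all_algebra.
From mathcomp Require Import all_classical all_reals all_analysis.
From mathcomp Require Import ring lra zify.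
Import Order.TTheory GRing.Theory Num.Theory.
Import numFieldNormedType.Exports.
Set Implicit Arguments.
Unset Strict Implicit.
Unset Printing Implicit Defensive.

Local Open Scope classical_set_scope.
Local Open Scope ring_scope.

(** * Symmetric double sums *)

(** Serves twice: for the double sum behind [cebysev_T], whose diagonal vanishes, and for the square
    of [lebesgue_fun], whose diagonal is the sum of the squares of the l_k. *)
Lemma sum_sym_pairs (R : pzSemiRingType) (n : nat) (F : 'I_n -> 'I_n -> R) :
  (forall i j, F i j = F j i) ->
  \sum_i \sum_j F i j =
    \sum_i F i i + 2 * \sum_(p : 'I_n * 'I_n | (p.1 < p.2)%N) F p.1 p.2.
Proof.
move=> Fsym.
have swap : \sum_(p : 'I_n * 'I_n | (p.2 < p.1)%N) F p.1 p.2 =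
    \sum_(p : 'I_n * 'I_n | (p.1 < p.2)%N) F p.1 p.2.
  rewrite (reindex_inj (h := fun p : 'I_n * 'I_n => (p.2, p.1))) /=; last first.
    by move=> [a b] [c d] [-> ->].
  by apply: eq_bigr => p _; rewrite Fsym.
have diag : \sum_i F i i = \sum_(p : 'I_n * 'I_n | p.1 == p.2) F p.1 p.2.
  rewrite -(pair_big_dep xpredT (fun i j => i == j) (fun i j => F i j)) /=.
  apply: eq_bigr => i _.
  by rewrite (eq_bigl (pred1 i)) ?big_pred1_eq // => j; rewrite /= eq_sym.
rewrite pair_big /= (bigID (fun p : 'I_n * 'I_n => p.1 == p.2)) /= -diag.
congr (_ + _).
rewrite (bigID (fun p : 'I_n * 'I_n => (p.1 < p.2)%N)) /= mulr2n mulrDl mul1r.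
congr (_ + _).
  by apply: eq_bigl => p /=; rewrite -val_eqE /=; case: ltngtP.
rewrite -[RHS]swap.
by apply: eq_bigl => p /=; rewrite -val_eqE /=; case: ltngtP.
Qed.

(** * Chebyshev polynomials *)

(** [p] is T_j; the size bound makes its interpolation at n nodes exact when j < n. *)
Lemma cos_nat_poly (R : realType) (j : nat) :
  exists2 p : {poly R}, (size p <= j.+1)%N &
    forall t : R, p.[cos t] = cos (j%:R * t).
Proof.
(* The recurrence T_(j+2) = 2 X T_(j+1) - T_j has order two, so the induction carries two
   consecutive polynomials. *)
suff [p [_ [sp _ pE _]]] : exists p q : {poly R}, [/\ (size p <= j.+1)%N,
    (size q <= j.+2)%N, forall t : R, p.[cos t] = cos (j%:R * t) &
    forall t : R, q.[cos t] = cos (j.+1%:R * t)] by exists p.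
elim: j => [|j [p [q [sp sq pE qE]]]].
  exists 1, 'X; split; rewrite ?size_poly1 ?size_polyX // => t.
    by rewrite hornerC mul0r cos0.
  by rewrite hornerX mul1r.
exists q, (2%:P * ('X * q) - p); split => // [|t].
  rewrite (leq_trans (size_polyD _ _)) // size_polyN geq_max.
  rewrite (leq_trans sp) ?andbT; last by rewrite !ltnS -addn2 leq_addr.
  rewrite mul_polyC (leq_trans (size_scale_leq _ _)) //.
  rewrite (leq_trans (size_polyMleq _ _)) // size_polyX /=.
  by rewrite ltnS.
rewrite hornerD hornerN !hornerM hornerC hornerX pE qE.
have -> : j.+2%:R * t = j.+1%:R * t + t by rewrite -[j.+2]addn1 natrD; ring.
have -> : j%:R * t = j.+1%:R * t - t by rewrite -[j.+1]addn1 natrD; ring.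
by rewrite cosB cosD; ring.
Qed.

(** * Chebyshev nodes and Lagrange interpolation *)

(** The angle theta_k whose cosine is, by definition, [cheb_node]; it is named so that its multiples
    can be used. *)
Definition cheb_angle (R : realType) (n : nat) (i : 'I_n) : R :=
  (2 * i.+1%:R - 1) * pi / (2 * n%:R).

Section ChebyshevNodes.
Variables (R : realType) (n : nat).
Hypothesis n_gt0 : (0 < n)%N.
Implicit Types (i k : 'I_n) (p : {poly R}).

Let n_gt0R : (0 : R) < n%:R. Proof. by rewrite ltr0n. Qed.

Lemma cheb_angle_pi i : cheb_angle R i \in `[0, pi].
Proof.
have i1 : (1 : R) <= i.+1%:R by rewrite ler1n.
have i2 : (i.+1%:R : R) <= n%:R by rewrite ler_nat.
have pi0 := pi_ge0 R.
rewrite in_itv /= /cheb_angle; apply/andP; split.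
  by rewrite divr_ge0 ?mulr_ge0 //; lra.
rewrite ler_pdivrMr; last lra.
by rewrite [X in X <= _]mulrC ler_wpM2l //; lra.
Qed.

Lemma cheb_node_inj : injective (@cheb_node R n).
Proof.
move=> i k /(cos_inj (cheb_angle_pi i) (cheb_angle_pi k)) e.
have d0 : (2 * n%:R : R) != 0 by rewrite mulf_neq0 ?gt_eqF // ltr0n.
have pi0 : (pi : R) != 0 by rewrite gt_eqF ?pi_gt0.
move: e => /(mulIf (invr_neq0 d0)) /(mulIf pi0) e.
apply/val_inj/succn_inj/eqP; rewrite -(eqr_nat R); apply/eqP.
by move: e; rewrite /=; lra.
Qed.

Lemma cheb_omega_div i :
  cheb_omega R n %/ ('X - (cheb_node R i)%:P) =
    \prod_(k | k != i) ('X - (cheb_node R k)%:P).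
Proof. by rewrite /cheb_omega (bigD1 i) //= mulrC mulpK ?polyXsubC_eq0. Qed.

Lemma deriv_cheb_omega i :
  (cheb_omega R n)^`().[cheb_node R i] =
    (\prod_(k | k != i) ('X - (cheb_node R k)%:P)).[cheb_node R i].
Proof.
rewrite /cheb_omega (bigD1 i) //= derivM derivXsubC mul1r hornerD hornerM.
by rewrite hornerXsubC subrr mul0r addr0.
Qed.

Lemma lagrange_fund_node i k :
  (lagrange_fund R i).[cheb_node R k] = (i == k)%:R.
Proof.
rewrite /lagrange_fund cheb_omega_div deriv_cheb_omega hornerZ.
case: eqVneq => [->|ik].
  rewrite mulVf // horner_prod; apply/prodf_neq0 => m mk.
  by rewrite hornerXsubC subr_eq0 (inj_eq cheb_node_inj) eq_sym.
rewrite [X in _ * X]horner_prod [X in _ * X](bigD1 k) 1?eq_sym //=.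
by rewrite hornerXsubC subrr mul0r mulr0.
Qed.

Lemma size_lagrange_fund i : (size (lagrange_fund R i) <= n)%N.
Proof.
rewrite (leq_trans (size_scale_leq _ _)) // size_divp ?polyXsubC_eq0 //.
rewrite size_XsubC /cheb_omega -big_enum.
by rewrite size_prod_XsubC size_enum_ord /= subn1.
Qed.

(** The difference between [p] and its interpolant [q] has size at most n and vanishes at n distinct
    nodes, hence is zero. *)
Lemma lagrange_interp p x : (size p <= n)%N ->
  \sum_(i < n) p.[cheb_node R i] * (lagrange_fund R i).[x] = p.[x].
Proof.
move=> sp; pose q := \sum_(i < n) p.[cheb_node R i] *: lagrange_fund R i.
suff -> : p = q.
  rewrite {2}/q horner_sum; apply: eq_bigr => i _.
  rewrite hornerZ; congr (_ * _).
  rewrite /q horner_sum (bigD1 i) //= hornerZ lagrange_fund_node eqxx mulr1.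
  rewrite big1 ?addr0 // => k ki.
  by rewrite hornerZ lagrange_fund_node (negbTE ki) mulr0.
apply/eqP; rewrite -subr_eq0; apply/negPn/negP => pq0.
have := max_poly_roots (rs := [seq cheb_node R i | i : 'I_n]) pq0.
rewrite size_image card_ord (map_inj_uniq cheb_node_inj) enum_uniq.
have -> : all (root (p - q)) [seq cheb_node R i | i : 'I_n].
  apply/allP => _ /mapP[i _ ->]; rewrite rootE hornerD hornerN horner_sum.
  rewrite (bigD1 i) //= hornerZ lagrange_fund_node eqxx mulr1.
  rewrite big1 ?addr0 ?subrr // => k ki.
  by rewrite hornerZ lagrange_fund_node (negbTE ki) mulr0.
move=> /(_ isT isT); rewrite ltnNge => /negP; apply.
rewrite (leq_trans (size_polyD _ _)) // size_polyN geq_max sp /=.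
rewrite (leq_trans (size_sum _ _ _)) //; apply/bigmax_leqP => i _.
by rewrite (leq_trans (size_scale_leq _ _)) // size_lagrange_fund.
Qed.

Lemma lagrange_interp_cos j t : (j < n)%N ->
  \sum_(i < n) cos (j%:R * cheb_angle R i) * (lagrange_fund R i).[cos t] =
    cos (j%:R * t).
Proof.
move=> jn; have [p sp pE] := cos_nat_poly R j.
rewrite -pE -lagrange_interp ?(leq_trans sp) //.
by apply: eq_bigr => i _; rewrite -pE.
Qed.

(** * Discrete orthogonality and Bessel's inequality *)

(** With h = m pi / (2n) the angles are the odd multiples of h. Multiplied by 2 sin h, the sum
    telescopes to sin (m pi) = 0, and sin h > 0 because 0 < m < 2n. *)
Lemma sum_cos_angle m : (0 < m < n.*2)%N ->
  \sum_(i < n) cos (m%:R * cheb_angle R i) = 0.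
Proof.
move=> /andP[m0 mn].
set h : R := m%:R * pi / (2 * n%:R).
have h_gt0 : 0 < sin h.
  have m0R : (0 : R) < m%:R by rewrite ltr0n.
  have mnR : (m%:R : R) < 2 * n%:R by rewrite -natrM ltr_nat mul2n.
  rewrite sin_gt0_pi // /h divr_gt0 ?mulr_gt0 ?pi_gt0 //=.
  by rewrite ltr_pdivrMr ?mulr_gt0 // mulrC ltr_pM2l ?pi_gt0.
apply: (mulfI (lt0r_neq0 h_gt0)); rewrite mulr0.
apply: (mulfI (_ : 2 != 0 :> R)) => //; rewrite mulr0 2!mulr_sumr.
pose s (k : nat) : R := sin (k%:R * (2 * h)).
rewrite (eq_bigr (fun i : 'I_n => s i.+1 - s i)) => [|i _]; last first.
  have e1 : m%:R * cheb_angle R i = i%:R * (2 * h) + h.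
    by rewrite /cheb_angle /h -[i.+1]addn1 natrD; field; rewrite gt_eqF.
  have e2 : i.+1%:R * (2 * h) = (i%:R * (2 * h) + h) + h.
    by rewrite -[i.+1]addn1 natrD; ring.
  have e3 : i%:R * (2 * h) = (i%:R * (2 * h) + h) - h by ring.
  by rewrite /s e1 e2 [X in _ - sin X]e3 sinD sinB; ring.
rewrite -(big_mkord xpredT (fun i : nat => s i.+1 - s i)) telescope_sumr //.
rewrite /s mul0r sin0 subr0.
have -> : n%:R * (2 * h) = m%:R * pi by rewrite /h; field; rewrite gt_eqF.
elim: (m) => [|k IH]; first by rewrite mul0r sin0.
by rewrite -[k.+1]addn1 natrD mulrDl mul1r sinDpi IH oppr0.
Qed.

(** The product formula leaves sums at the frequencies j - i and j + i, both below 2n, and only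
    frequency 0 contributes: twice if i = j = 0, once if i = j > 0. *)
Lemma cos_angle_ortho (i j : 'I_n) :
  \sum_(k < n) cos (i%:R * cheb_angle R k) * cos (j%:R * cheb_angle R k) =
    if i == j then n%:R / (if val i == 0%N then 1 else 2) else 0.
Proof.
(* The order makes the natural number [j - i] a true difference. *)
wlog ij : i j / (i <= j)%N => [H|].
  have [/H //|/ltnW ji] := leqP i j.
  rewrite eq_sym; under eq_bigr do rewrite mulrC.
  by rewrite H //; case: eqVneq => // ->.
have prodE k : cos (i%:R * cheb_angle R k) * cos (j%:R * cheb_angle R k) =
    (cos ((j - i)%N%:R * cheb_angle R k) +
     cos ((j + i)%N%:R * cheb_angle R k)) / 2.
  by rewrite natrB // natrD mulrBl [(_ + _) * cheb_angle _ _]mulrDl cosB cosD;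
    field.
rewrite (eq_bigr _ (fun k _ => prodE k)) -mulr_suml big_split /=.
have lt2 : (j + i < n.*2)%N by have := ltn_ord i; have := ltn_ord j; lia.
have cos0_sum : \sum_(k < n) cos (0%N%:R * cheb_angle R k) = n%:R.
  rewrite (eq_bigr (fun=> 1)) ?sumr_const ?card_ord // => k _.
  by rewrite mul0r cos0.
case: eqVneq => [eij|nij].
  rewrite eij subnn cos0_sum.
  case: eqVneq => [->|j0]; first by rewrite cos0_sum; field.
  rewrite sum_cos_angle ?addr0 //; rewrite eij in lt2.
  by apply/andP; split=> //; rewrite addnn double_gt0 lt0n.
have {}ij : (i < j)%N by rewrite ltn_neqAle ij andbT.
by rewrite !sum_cos_angle ?addr0 ?mul0r //; lia.
Qed.

(* Bessel's inequality for the orthogonal vectors (cos (j theta_k))_k. *)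
Lemma sum_sqr_lagrange_ge t :
  \sum_(j < n) (if val j == 0%N then 1 else 2) * cos (j%:R * t) ^+ 2 <=
    n%:R * \sum_(i < n) (lagrange_fund R i).[cos t] ^+ 2.
Proof.
(* [w j / n] is the inverse of the squared norm of the vector [v j] below. *)
pose w (j : 'I_n) : R := if val j == 0%N then 1 else 2.
have w0 j : w j != 0 by rewrite /w; case: ifP; rewrite ?oner_eq0 ?pnatr_eq0.
pose l i := (lagrange_fund R i).[cos t].
pose v (j k : 'I_n) : R := cos (j%:R * cheb_angle R k).
(* [K] is n times the orthogonal projection of [l] on the span of the [v j], since the scalar
   product of [l] and [v j] is cos (jt). *)
pose K k := \sum_j w j * cos (j%:R * t) * v j k.
set S := (X in X <= _).
have lK : \sum_k l k * K k = S.
  under eq_bigr do rewrite mulr_sumr; rewrite exchange_big /=.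
  apply: eq_bigr => j _.
  rewrite expr2 [RHS]mulrA -[X in _ = _ * X](lagrange_interp_cos t (ltn_ord j)).
  rewrite [RHS]mulr_sumr.
  by apply: eq_bigr => k _; rewrite /v /l /w; ring.
have KK : \sum_k K k ^+ 2 = n%:R * S.
  have -> : \sum_k K k ^+ 2 = \sum_i \sum_j
      w i * cos (i%:R * t) * (w j * cos (j%:R * t)) * \sum_k v i k * v j k.
    under eq_bigr do rewrite expr2 /K mulr_suml.
    rewrite exchange_big; apply: eq_bigr => i _ /=.
    under eq_bigr do rewrite mulr_sumr.
    rewrite exchange_big; apply: eq_bigr => j _ /=.
    by rewrite mulr_sumr; apply: eq_bigr => k _; ring.
  rewrite mulr_sumr; apply: eq_bigr => i _; rewrite (bigD1 i) //=.
  rewrite [X in _ + X]big1 ?addr0 => [|j ji];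
    rewrite /v cos_angle_ortho; last first.
    by rewrite eq_sym (negbTE ji) mulr0.
  by rewrite eqxx -/(w i); field.
(* By [lK] and [KK] this square expands to n^2 |l|^2 - 2nS + nS; dividing by n gives the claim. *)
have : 0 <= \sum_k (n%:R * l k - K k) ^+ 2.
  by apply: sumr_ge0 => k _; exact: sqr_ge0.
have -> : \sum_k (n%:R * l k - K k) ^+ 2 =
    n%:R ^+ 2 * \sum_k l k ^+ 2 - 2 * n%:R * \sum_k l k * K k + \sum_k K k ^+ 2.
  rewrite !mulr_sumr -sumrB -big_split /=.
  by apply: eq_bigr => k _; ring.
rewrite lK KK => H.
rewrite -(ler_pM2l n_gt0R) -subr_ge0.
by move: H; rewrite /l; set s := \sum_i _; congr (_ <= _); ring.
Qed.

End ChebyshevNodes.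

(** * A lower bound for the sum of the squares of the l_k, uniform in n and t *)

(** With u = cos^2 a the right-hand side is u + (2u - 1)^2 = 4 (u - 3/8)^2 + 7/16. *)
Lemma cos2_double_ge (R : realType) (a : R) :
  7 / 16 <= cos a ^+ 2 + cos (2 * a) ^+ 2.
Proof.
rewrite (mulr_natl a 2) cos_mulr2n; set u := cos a ^+ 2.
have := sqr_ge0 (u - 3 / 8); rewrite -mulr_natl; nra.
Qed.

(** Pairing j with 2j for j < n/2 bounds twice the sum from below, as the terms of index j and those
    of index 2j each form a part of the whole sum. *)
Lemma sum_cos2_ge (R : realType) (n : nat) (t : R) : (0 < n)%N ->
  n%:R / 16 <= \sum_(0 <= j < n) cos (j%:R * t) ^+ 2.
Proof.
move=> n_gt0; pose F j : R := cos (j%:R * t) ^+ 2; rewrite -/(F _).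
have F0 j : 0 <= F j by exact: sqr_ge0.
have mono m : (m <= n)%N -> \sum_(0 <= j < m) F j <= \sum_(0 <= j < n) F j.
  by move=> mn; rewrite [leRHS](big_cat_nat _ mn) //= lerDl sumr_ge0.
have even m : \sum_(0 <= j < m) F j.*2 <= \sum_(0 <= j < m.*2) F j.
  elim: m => [|m IH]; first by rewrite !big_geq.
  rewrite doubleS !big_nat_recr //=; have := F0 m.*2.+1; lra.
have m2n : (n./2.*2 <= n)%N by lia.
have mn : (n./2 <= n)%N by lia.
(* The term j = 0 makes up for the rounding in [n./2], in particular when n = 1. *)
have B1 : 1 <= \sum_(0 <= j < n) F j.
  by rewrite (le_trans _ (mono _ n_gt0)) // big_nat1 /F mul0r cos0 expr1n.
have B2 : 7 / 16 * n./2%:R <= \sum_(0 <= j < n./2) (F j + F j.*2).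
  rewrite mulr_natr -{1}[n./2]subn0 -sumr_const_nat.
  apply: ler_sum => j _; rewrite /F -mul2n natrM -mulrA; exact: cos2_double_ge.
rewrite big_split /= in B2.
have := mono _ mn; have := mono _ m2n; have := even n./2.
have : (n%:R : R) <= 2 * n./2%:R + 1.
  by rewrite -natrM natr1 ler_nat; lia.
move: B1 B2; rewrite /F; lra.
Qed.

(** The weights in Bessel's inequality are at least 1, so the sum of the cos^2 (jt) bounds it from
    below. *)
Lemma sum_sqr_lagrange_lb (R : realType) (n : nat) (t : R) : (0 < n)%N ->
  1 / 16 <= \sum_i (@lagrange_fund R n i).[cos t] ^+ 2.
Proof.
move=> n_gt0; have nR : (0 : R) < n%:R by rewrite ltr0n.
rewrite -(ler_pM2l nR) (le_trans _ (sum_sqr_lagrange_ge n_gt0 t)) //.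
rewrite mul1r (le_trans (sum_cos2_ge t n_gt0)) // big_mkord ler_sum // => j _.
by rewrite ler_peMl ?sqr_ge0 //; case: ifP => _; lra.
Qed.

(** * The functional T as a sum over pairs, and the two inequalities *)

Lemma cebysev_T_pairs (R : realType) (n : nat) (f g : R -> R) (t : R) :
  (0 < n)%N ->
  cebysev_T n f g (cos t) = \sum_(p : 'I_n * 'I_n | (p.1 < p.2)%N)
    (f (cheb_node R p.1) - f (cheb_node R p.2)) *
    (g (cheb_node R p.1) - g (cheb_node R p.2)) *
    ((lagrange_fund R p.1).[cos t] * (lagrange_fund R p.2).[cos t]).
Proof.
move=> n_gt0; pose l i := (@lagrange_fund R n i).[cos t].
pose a i := f (@cheb_node R n i); pose b i := g (@cheb_node R n i).
(* Exactness for the constant T_0, that is j = 0. *)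
have l1 : \sum_i l i = 1.
  have := lagrange_interp_cos n_gt0 t n_gt0; rewrite mul0r cos0 => <-.
  by apply: eq_bigr => i _; rewrite mul0r cos0 mul1r.
have := @sum_sym_pairs R n (fun i j => (a i - a j) * (b i - b j) * (l i * l j)).
rewrite [X in _ = X + _]big1 ?add0r => [|i _]; last by rewrite subrr !mul0r.
move=> /(_ (fun i j => ltac:(ring))) H.
apply: (mulfI (_ : 2 != 0 :> R)) => //; rewrite -H /cebysev_T /lagrange_op.
(* A factor [\sum_j l j], equal to 1, turns the single sum into a double one. *)
have -> : \sum_(i < n) (f \* g) (cheb_node R i) * (lagrange_fund R i).[cos t] =
    \sum_i \sum_j a i * b i * l i * l j.
  by apply: eq_bigr => i _; rewrite -mulr_sumr l1 mulr1.
have -> : (\sum_i f (cheb_node R i) * (@lagrange_fund R n i).[cos t]) *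
    (\sum_i g (cheb_node R i) * (@lagrange_fund R n i).[cos t]) =
    \sum_i \sum_j a i * l i * (b j * l j).
  by rewrite mulr_suml; apply: eq_bigr => i _; rewrite mulr_sumr.
rewrite mulr_natl mulr2n.
(* Exchanging i and j in one of the two copies of T yields the four terms of the product (a_i - a_j)
   (b_i - b_j). *)
rewrite [X in X - _ + _]exchange_big [X in _ - X + _]exchange_big /=.
rewrite -!sumrB -big_split /=.
apply: eq_bigr => i _; rewrite -!sumrB -big_split /=.
by apply: eq_bigr => j _; ring.
Qed.

Lemma osc_ge0 (R : realType) (n : nat) (f : R -> R) : 0 <= osc n f.
Proof. exact: bigmax_ge_id. Qed.

Lemma osc_ge (R : realType) (n : nat) (f : R -> R) (i j : 'I_n) : (i < j)%N ->
  `|f (cheb_node R i) - f (cheb_node R j)| <= osc n f.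
Proof.
move=> ij; exact: (le_bigmax_cond _
  (fun p : 'I_n * 'I_n => `|f (cheb_node R p.1) - f (cheb_node R p.2)|)
  (j := (i, j))).
Qed.

Theorem theorem4p5 (R : realType) :
  exists c : R, 0 < c /\
    forall (n : nat) (f g : R -> R) (x t : R),
      (0 < n)%N ->
      {within `[-1, 1], continuous f} ->
      {within `[-1, 1], continuous g} ->
      x \in `[-1, 1] ->
      x = cos t ->
      `|cebysev_T n f g x| <=
        osc n f * osc n g *
        \sum_(p : 'I_n * 'I_n | (p.1 < p.2)%N)
          `|(lagrange_fund R p.1).[x] * (lagrange_fund R p.2).[x]|
      /\
      osc n f * osc n g *
        \sum_(p : 'I_n * 'I_n | (p.1 < p.2)%N)
          `|(lagrange_fund R p.1).[x] * (lagrange_fund R p.2).[x]| <=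
        osc n f * osc n g *
        ((lebesgue_fun n x ^+ 2
            - c * (1 + cos (n%:R * t) ^+ 2 * (pi ^+ 2 / 6))) / 2).
Proof.
have pi2 : (0 : R) <= pi ^+ 2 / 6 by rewrite divr_ge0 ?sqr_ge0.
have d_gt0 : (0 : R) < 1 + pi ^+ 2 / 6 by lra.
(* Since cos^2 (nt) <= 1, this is the value of c for which the subtracted term never exceeds
   1/16. *)
exists ((1 / 16) / (1 + pi ^+ 2 / 6)); split; first by rewrite divr_gt0.
move=> n f g x t n_gt0 _ _ _ ->; split.
  rewrite cebysev_T_pairs // mulr_sumr (le_trans (ler_norm_sum _ _ _)) //.
  apply: ler_sum => p p12; rewrite normrM ler_wpM2r // normrM.
  by rewrite ler_pM // osc_ge.
rewrite ler_wpM2l ?mulr_ge0 ?osc_ge0 //.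
set P := (X in X <= _); pose l i := (@lagrange_fund R n i).[cos t].
(* Hence P is half of Lambda_n^2 minus the sum of the squares, and it remains to compare that sum
   with [q]. *)
have -> : lebesgue_fun n (cos t) ^+ 2 = \sum_i l i ^+ 2 + 2 * P.
  rewrite expr2 /lebesgue_fun mulr_suml.
  under eq_bigr do rewrite mulr_sumr.
  rewrite (@sum_sym_pairs R n (fun i j => `|l i| * `|l j|)) => [|i j].
    congr (_ + 2 * _); apply: eq_bigr => k _; last by rewrite normrM.
    by rewrite -normrM -expr2 ger0_norm ?sqr_ge0.
  exact: mulrC.
have Hl : 1 / 16 <= \sum_i l i ^+ 2 := sum_sqr_lagrange_lb t n_gt0.
have cos1 : cos (n%:R * t) ^+ 2 <= 1.
  by rewrite cos2sin2 lerBlDr lerDl sqr_ge0.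
set q := (X in _ - X).
suff : q <= 1 / 16 by move: Hl; lra.
rewrite /q mulrAC ler_pdivrMr // ler_pM2l //.
by rewrite lerD2l ler_piMl.
Qed.
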